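(* Let $M$ be a manifold of dimension $N$, $F_0:A_0\to[0,\infty)$ a conic Finsler metric on $M$ with fundamental tensor $g^0$ and angular metric $h^0$, and $\beta$ a one-form on $M$. For any $q\ne0$, consider the conic pseudo-Finsler metric $$F=F_0^{q+1}/|F_0-\beta|^q,\qquad A=\{v\in A_0:F_0(v)\ne\beta(v)\}$$ (with $\pi(A)=M$). Then its fundamental tensor $g$ is determined by $$\Big|\frac{F_0(v)-\beta(v)}{F_0(v)}\Big|^{2q+2}g_v(w,w)=\frac{(F_0(v)-\beta(v))(F_0(v)-(q+1)\beta(v))}{F_0(v)^2}h^0_v(w,w)$$ $$+\,q(q+1)\Big(\frac{\beta(v)}{F_0(v)^2}g^0_v(v,w)-\beta(w)\Big)^2+\Big(\frac{F_0(v)-(q+1)\beta(v)}{F_0(v)^2}g^0_v(v,w)+q\beta(w)\Big)^2,$$ for any $v\in A$ and $w\in T_{\pi(v)}M$. When $q>0$ or $q\le-1$, the restriction of $F$ to $$A^*=\{v\in A_0:(F_0(v)-(q+1)\beta(v))(F_0(v)-\beta(v))>0\}$$ is conic Finsler (i.e. $g_v$ is positive definite for every $v\in A^*$) and, if $N>2$, $g$ is not strongly convex at any point of $A\setminus A^*$ (i.e. $g_v$ is not positive definite for any $v\in A\setminus A^*$).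
   Context: Let $\pi:TM\to M$ be the natural projection. A conic pseudo-Finsler metric on $M$ with domain $A$ is a continuous function $F:A\to[0,\infty)$, where $A\subset TM$ is open with $\pi(A)=M$ and conic ($v\in A$, $\lambda>0$ imply $\lambda v\in A$), which is smooth on $A$ except at most at the zero vectors, with $F(v)=0$ iff $v$ is a zero vector and $F(\lambda v)=\lambda F(v)$ for $\lambda>0$, $v\in A$. Its fundamental tensor is $g_v(u,w)=\frac12\frac{\partial^2}{\partial t\partial s}F(v+tu+sw)^2|_{t=s=0}$ for nonzero $v\in A$ and $u,w\in T_{\pi(v)}M$. It is a conic Finsler metric if $g_v$ is positive definite for all nonzero $v\in A$. The angular metric of $F_0$ is $h^0_v(w,w)=g^0_v(w,w)-\frac1{F_0(v)^2}g^0_v(v,w)^2$. *)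

(* Defs.v *)
From HB Require Import structures.
From mathcomp Require Import all_boot all_order all_algebra.
From mathcomp Require Import all_classical all_reals all_analysis.
Set Implicit Arguments.
Unset Strict Implicit.
Unset Printing Implicit Defensive.
Import Order.TTheory GRing.Theory Num.Theory.
Import numFieldNormedType.Exports.
Local Open Scope classical_set_scope.
Local Open Scope ring_scope.

(* C^k and C^oo maps on an open set D of a (finite-dimensional) normed space;
   the values of f outside D play no role. *)
Fixpoint class_C (R : realType) (V W : normedModType R) (k : nat)
    (D : set V) (f : V -> W) : Prop :=
  match k with
  | 0 => forall x, D x -> {for x, continuous f}
  | k'.+1 => (forall x, D x -> differentiable f x) /\
             (forall v : V, class_C k' D (fun x => 'D_v f x))
  end.

Definition smooth (R : realType) (V W : normedModType R) (D : set V)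
  (f : V -> W) : Prop := forall k, class_C k D f.

(* A smooth N-manifold without boundary, given by a smooth atlas.  Charts are
   total functions; only [chart i] on [chart_dom i], and its inverse
   [chart_inv i] on the image, are meaningful. *)
Record smoothManifold (R : realType) (N : nat) := SmoothManifold {
  carrier :> topologicalType;
  carrier_hausdorff : hausdorff_space carrier;
  carrier_countable : @second_countable carrier;
  chart_index : Type;
  chart_dom : chart_index -> set carrier;
  chart : chart_index -> carrier -> 'rV[R]_N;
  chart_inv : chart_index -> 'rV[R]_N -> carrier;
  chart_dom_open : forall i, open (chart_dom i);
  chart_cover : forall x : carrier, exists i, chart_dom i x;
  chartK : forall i (x : carrier),
    chart_dom i x -> chart_inv i (chart i x) = x;
  chart_im_open : forall i, open (chart i @` chart_dom i);
  chart_continuous : forall i (x : carrier),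
    chart_dom i x -> {for x, continuous (chart i)};
  chart_inv_continuous : forall i (y : 'rV[R]_N),
    (chart i @` chart_dom i) y -> {for y, continuous (chart_inv i)};
  transition_smooth : forall i j,
    smooth (chart i @` (chart_dom i `&` chart_dom j))
      (fun y => chart j (chart_inv i y))
}.

Definition transition (R : realType) (N : nat) (M : smoothManifold R N)
    (i j : chart_index M) (y : 'rV[R]_N) : 'rV[R]_N :=
  chart j (chart_inv i y).

(* A tangent vector at x is the family of its coordinate vectors in all the
   charts at x, related by the differentials of the transition maps (with the
   dummy value 0 at the charts that do not contain x). *)
Section tangent_space.
Context (R : realType) (N : nat) (M : smoothManifold R N) (x : M).
Implicit Types (i j : chart_index M).

Definition is_tangent : {pred (chart_index M -> 'rV[R]_N)} := fun v =>
  `[< (forall i, ~ chart_dom i x -> v i = 0) /\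
      (forall i j, chart_dom i x -> chart_dom j x ->
        v j = 'd (transition i j) (chart i x) (v i)) >].

Fact is_tangent_submod_closed : submod_closed is_tangent.
Proof.
split=> [|a u v /asboolP[u0 ut] /asboolP[v0 vt]]; apply/asboolP; split.
- by [].
- by move=> i j xi xj; rewrite linear0.
- move=> i xi.
  by rewrite -[LHS]/(a *: u i + v i) (u0 i xi) (v0 i xi) scaler0 addr0.
- move=> i j xi xj; rewrite -[LHS]/(a *: u j + v j).
  by rewrite (ut i j xi xj) (vt i j xi xj) -linearP.
Qed.

HB.instance Definition _ := GRing.isSubmodClosed.Build R
  (chart_index M -> 'rV[R]_N) is_tangent is_tangent_submod_closed.

Record tangent := Tangent {
  coord_fam :> chart_index M -> 'rV[R]_N;
  _ : coord_fam \in is_tangent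
}.

HB.instance Definition _ := [isSub for coord_fam].
HB.instance Definition _ := [Choice of tangent by <:].
HB.instance Definition _ := [SubChoice_isSubLmodule of tangent by <:].

End tangent_space.

Arguments tangent {R N M} x.

Section chart_differentials.
Context (R : realType) (N : nat) (M : smoothManifold R N).
Implicit Types (i j k : chart_index M) (x : M) (a : 'rV[R]_N).

Lemma near_transition i x (P : set M) : chart_dom i x -> nbhs x P ->
  \forall y \near chart i x, P (chart_inv i y).
Proof.
move=> xi Px.
have := @chart_inv_continuous _ _ M i (chart i x) (imageP _ xi).
by apply; rewrite chartK.
Qed.

Lemma transition_differentiable i j x : chart_dom i x -> chart_dom j x ->
  differentiable (transition i j) (chart i x).
Proof.
move=> xi xj; have [+ _] := @transition_smooth _ _ M i j 1%N.
by apply; exists x.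
Qed.

Lemma near_diff (V W : normedModType R) (f g : V -> W) (x : V) :
  (\near x, f x = g x) -> differentiable f x -> differentiable g x ->
  'd f x = 'd g x :> (V -> W).
Proof.
move=> fg df dg; apply/funext => v.
rewrite -!deriveE//; have [->|v0] := eqVneq v 0.
  by rewrite !deriveE// !linear0.
exact: near_eq_derive.
Qed.

Lemma diff_transition_id i x a : chart_dom i x ->
  'd (transition i i) (chart i x) a = a.
Proof.
move=> xi; rewrite (@near_diff _ _ _ id); first by rewrite diff_val.
- have : open_nbhs (chart i x) (chart i @` chart_dom i).
    by split; [exact: chart_im_open|exists x].
  move=> /open_nbhs_nbhs; apply: filterS => _ [z zi <-].
  by rewrite /transition chartK.
- exact: transition_differentiable.
- exact: ex_diff.
Qed.

Lemma diff_transition_comp i j k x a :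
  chart_dom i x -> chart_dom j x -> chart_dom k x ->
  'd (transition i k) (chart i x) a =
  'd (transition j k) (chart j x) ('d (transition i j) (chart i x) a).
Proof.
move=> xi xj xk.
have e : transition i j (chart i x) = chart j x by rewrite /transition chartK.
have dij := transition_differentiable xi xj.
have djk := transition_differentiable xj xk.
have djk' : differentiable (transition j k) (transition i j (chart i x)).
  by rewrite e.
have dc := differentiable_comp dij djk'.
transitivity ('d (transition j k \o transition i j) (chart i x) a); last first.
  pose app (h : 'rV[R]_N -> 'rV[R]_N) := h a.
  apply: (eq_trans (congr1 app (diff_comp dij djk'))).
  rewrite /app.
  exact: (congr1 (fun y => 'd (transition j k) y _) e).
apply: (congr1 (fun h : 'rV[R]_N -> 'rV[R]_N => h a)).
apply: near_diff.
- have xj' : nbhs x (chart_dom j).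
    by apply: open_nbhs_nbhs; split => //; exact: chart_dom_open.
  have := near_transition xi xj'; apply: filterS => y yj.
  by rewrite /= /transition chartK.
- exact: transition_differentiable.
- exact: dc.
Qed.

Definition of_chart_fam i x a : chart_index M -> 'rV[R]_N := fun j =>
  if `[< chart_dom i x /\ chart_dom j x >]
  then 'd (transition i j) (chart i x) a else 0.

Fact of_chart_is_tangent i x a : of_chart_fam i x a \in is_tangent x.
Proof.
apply/asboolP; split=> [j xj|j k xj xk].
  by rewrite /of_chart_fam; case: asboolP => // -[].
rewrite /of_chart_fam; have [xi|xi] := pselect (chart_dom i x).
  by rewrite !asboolT//; exact: diff_transition_comp.
by rewrite !asboolF ?linear0// => -[].
Qed.

(* the vector at x with coordinates a in the chart i *)
Definition of_chart i x a : tangent x := Tangent (of_chart_is_tangent i x a).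

Lemma of_chartE i x a : chart_dom i x -> of_chart i x a i = a.
Proof.
by move=> xi; rewrite /= /of_chart_fam asboolT// diff_transition_id.
Qed.

Lemma of_chartK i x (v : tangent x) : chart_dom i x -> of_chart i x (v i) = v.
Proof.
move=> xi; apply: val_inj; apply/funext => j /=; rewrite /of_chart_fam.
case: v => v /= /asboolP[v0 vt]; case: asboolP => [[_ xj]|nxj].
  by rewrite (vt i j).
by rewrite v0// => xj; exact: nxj.
Qed.

End chart_differentials.

(* The tangent bundle, with the topology induced by the charts of M. *)
Record tangent_bundle (R : realType) (N : nat) (M : smoothManifold R N) :=
  TVec { base : M; vect : tangent base }.

Section tangent_bundle_topology.
Context (R : realType) (N : nat) (M : smoothManifold R N).
Implicit Types (i : chart_index M) (A B : set (tangent_bundle M)).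

HB.instance Definition _ := gen_eqMixin (tangent_bundle M).
HB.instance Definition _ := gen_choiceMixin (tangent_bundle M).

Definition tchart_dom i : set (tangent_bundle M) :=
  [set p | chart_dom i (base p)].

Definition tchart i (p : tangent_bundle M) : 'rV[R]_N * 'rV[R]_N :=
  (chart i (base p), vect p i).

Definition tchart_inv i (z : 'rV[R]_N * 'rV[R]_N) : tangent_bundle M :=
  TVec (of_chart i (chart_inv i z.1) z.2).

Lemma tchartK i p : tchart_dom i p -> tchart_inv i (tchart i p) = p.
Proof.
case: p => x v xi; rewrite /tchart_inv /= chartK//.
by rewrite of_chartK.
Qed.

Lemma tchart_invK i z : (chart i @` chart_dom i) z.1 ->
  tchart i (tchart_inv i z) = z.
Proof.
case: z => y a /= [x xi <-]; rewrite /tchart /tchart_inv chartK//.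
by congr pair; exact: of_chartE.
Qed.

Definition tangent_open A := forall i, open (tchart i @` (A `&` tchart_dom i)).

Fact tangent_openT : tangent_open setT.
Proof.
move=> i; rewrite setTI.
rewrite (_ : _ @` _ = fst @^-1` (chart i @` chart_dom i)).
  apply: open_comp; last exact: chart_im_open.
  by move=> z _; exact: cvg_fst.
apply/seteqP; split=> [_ [p pi <-]|z zi].
  by exists (base p).
exists (tchart_inv i z); last exact: tchart_invK.
by case: zi => x xi e; rewrite /tchart_dom /= -e chartK.
Qed.

Fact tangent_openI A B :
  tangent_open A -> tangent_open B -> tangent_open (A `&` B).
Proof.
move=> oA oB i; rewrite (_ : _ @` _ =
  tchart i @` (A `&` tchart_dom i) `&` tchart i @` (B `&` tchart_dom i)).
  exact: openI.
apply/seteqP; split=> [_ [p [[pA pB] pi] <-]|_ [[p [pA pi] <-]]].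
  by split; exists p.
move=> [q [qB qi]] qp; exists p => //; split=> //; split=> //.
by rewrite -(tchartK pi) -qp tchartK.
Qed.

Fact tangent_open_bigU (I : Type) (f : I -> set (tangent_bundle M)) :
  (forall k, tangent_open (f k)) -> tangent_open (\bigcup_k f k).
Proof.
move=> of_ i; rewrite setI_bigcupl image_bigcup.
by apply: bigcup_open => k _; exact: of_.
Qed.

HB.instance Definition _ := isOpenTopological.Build (tangent_bundle M)
  tangent_openT tangent_openI tangent_open_bigU.

End tangent_bundle_topology.

Record one_form (R : realType) (N : nat) (M : smoothManifold R N) := OneForm {
  form_at :> forall x : M, {scalar tangent x};
  form_smooth : forall i : chart_index M,
    exists2 b : 'rV[R]_N -> 'rV[R]_N, smooth (chart i @` chart_dom i) b &
      forall (x : M) (v : tangent x), chart_dom i x ->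
        form_at x v = \sum_(k < N) b (chart i x) 0 k * v i 0 k
}.

(* the function on TM associated with a one-form *)
Definition form_eval (R : realType) (N : nat) (M : smoothManifold R N)
    (beta : one_form M) (p : tangent_bundle M) : R :=
  beta (base p) (vect p).

(* Functions on A are total functions whose values outside A play no role. *)
Section conic_finsler.
Context (R : realType) (N : nat) (M : smoothManifold R N).
Implicit Types (A : set (tangent_bundle M)) (F : tangent_bundle M -> R).

Definition smooth_on A F : Prop := forall i : chart_index M,
  smooth (tchart i @` (A `&` tchart_dom i)) (F \o tchart_inv i).

Record conic_pseudo_finsler A F : Prop := {
  finsler_open : open A;
  finsler_proj : @base R N M @` A = [set: M];
  finsler_conic : forall (x : M) (v : tangent x) (l : R),
    0 < l -> A (TVec v) -> A (TVec (l *: v));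
  finsler_continuous : {within A, continuous F};
  finsler_ge0 : forall p, A p -> 0 <= F p;
  finsler_smooth : smooth_on (A `&` [set p | vect p != 0]) F;
  finsler_eq0 : forall p, A p -> F p = 0 <-> vect p = 0;
  finsler_homogeneous : forall (x : M) (v : tangent x) (l : R),
    0 < l -> A (TVec v) -> F (TVec (l *: v)) = l * F (TVec v)
}.

Definition fundamental_tensor F (x : M) (v u w : tangent x) : R :=
  2^-1 * derive1 (fun t : R =>
    derive1 (fun s : R => F (TVec (v + t *: u + s *: w)) ^+ 2) 0) 0.

(* the quadratic form w |-> h_v(w, w) *)
Definition angular_metric F (x : M) (v w : tangent x) : R :=
  fundamental_tensor F v w w -
  (F (TVec v) ^+ 2)^-1 * fundamental_tensor F v v w ^+ 2.

Definition strongly_convex_at F (p : tangent_bundle M) : Prop :=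
  forall w : tangent (base p), w != 0 ->
    0 < fundamental_tensor F (vect p) w w.

Definition conic_finsler A F : Prop :=
  conic_pseudo_finsler A F /\
  (forall p, A p -> vect p != 0 -> strongly_convex_at F p).

End conic_finsler.

(* Main.v *)
(** Everything reduces to one-variable calculus on the lines f(t) = F0(v + tw):
    g_v(w,w) is half the second derivative of f^2 at 0, while homogeneity gives
    g0_v(v,w) = f f' and h0_v(w,w) = f f''.  Since F^2 is the exponential of
    2(q+1) ln f - q ln (f - beta)^2, the formula for g is a field identity in
    f, f', f'', beta(v), beta(w).  Homogeneity also makes f'' invariant under
    w |-> w - l v, so h0_v(w,w) = g0_v(u,u) where u is the component of w that is
    g0_v-orthogonal to v; hence h0_v >= 0, with kernel spanned by v, and on A^*
    the three terms cannot vanish together.  Off A^*, when N > 2, some w <> 0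
    kills both linear forms g0_v(v,.) and beta, leaving only the nonpositive
    h0-term. *)

Require Import Defs.
From HB Require Import structures.
From mathcomp Require Import all_boot all_order all_algebra.
From mathcomp Require Import all_classical all_reals all_analysis.
From mathcomp Require Import ring.
Set Implicit Arguments.
Unset Strict Implicit.
Unset Printing Implicit Defensive.
Import Order.TTheory GRing.Theory Num.Theory.
Import numFieldNormedType.Exports.
Local Open Scope classical_set_scope.
Local Open Scope ring_scope.

(** * Calculus of C^k maps *)

(** The first-order expansion of [f] at [x] is also one of [g], since both the value at [x] and the
    nearby values agree; uniqueness of the differential then identifies it. *)
Lemma near_eq_differentiable (R : realType) (V W : normedModType R)
    (f g : V -> W) (x : V) :
  {near x, f =1 g} -> differentiable f x -> differentiable g x.
Proof.
move=> fg df.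
have fgx : f x = g x by exact: nbhs_singleton fg.
have gE : g \o shift x = cst (g x) + 'd f x +o_ 0 id.
  have /eqaddoP fE := diff_locally df; apply/eqaddoP => e e0.
  have fg0 : \forall h \near (0 : V), f (h + x) = g (h + x).
    by move: fg; rewrite (near_shift 0) /= subr0.
  by apply: filterS2 fg0 (fE e e0) => h; rewrite !fctE /= fgx => ->.
apply/diff_locallyP; rewrite (@diff_unique _ _ _ _ 'd f x)//.
  by split => //; exact: diff_continuous.
exact: diff_continuous.
Unshelve. all: by end_near. Qed.

Section class_C_calculus.
Context (R : realType) (V : normedModType R) (D : set V).
Hypothesis oD : open D.
Implicit Types (W : normedModType R) (f g : V -> R) (k : nat).

Lemma near_open (P : V -> Prop) (x : V) :
  (forall y, D y -> P y) -> D x -> \forall y \near x, P y.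
Proof. by move=> DP Dx; apply: filterS (open_nbhs_nbhs (conj oD Dx)). Qed.

(** On an open [D], equality on [D] is equality near each of its points, so directional derivatives
    agree on [D] too and the induction goes on. This allows derivatives to be replaced by explicit
    formulas valid only on [D]. *)
Lemma class_C_eq W k (f g : V -> W) :
  {in D, f =1 g} -> class_C k D f -> class_C k D g.
Proof.
elim: k f g => [|k IH] f g fg.
  move=> /= fc x Dx; have fgx : \forall y \near x, f y = g y.
    by apply: near_open Dx => y Dy; apply: fg; rewrite inE.
  rewrite /prop_for /continuous_at -(fg x) ?inE//.
  exact: cvg_trans (near_eq_cvg fgx) (fc x Dx).
move=> /= [df Df]; split=> [x Dx|v].
  apply: near_eq_differentiable (df x Dx).
  by apply: near_open Dx => y Dy; apply: fg; rewrite inE.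
apply: IH (Df v) => x; rewrite inE => Dx; apply: near_eq_derive.
by apply: near_open Dx => y Dy; apply: fg; rewrite inE.
Qed.

Lemma class_C_cst W k (c : W) : class_C k D (fun=> c).
Proof.
elim: k c => [|k IH] c; first by move=> x _; exact: cst_continuous.
split=> [x _|v]; first exact: differentiable_cst.
by apply: class_C_eq (IH 0) => x _; rewrite derive_cst.
Qed.

Lemma class_CW W k (f : V -> W) : class_C k.+1 D f -> class_C k D f.
Proof.
elim: k f => [|k IH] f [df Df].
  by move=> x Dx; exact/differentiable_continuous/df.
by split=> // v; exact/IH/Df.
Qed.

Lemma class_CD W k (f g : V -> W) :
  class_C k D f -> class_C k D g -> class_C k D (fun x => f x + g x).
Proof.
elim: k f g => [|k IH] f g.
  by move=> fc gc x Dx; apply: continuousD; [exact: fc|exact: gc].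
move=> [df Df] [dg Dg]; split=> [x Dx|v].
  by apply: differentiableD; [exact: df|exact: dg].
apply: class_C_eq (IH _ _ (Df v) (Dg v)) => x; rewrite inE => Dx.
by rewrite -deriveD//; apply: diff_derivable; [exact: df|exact: dg].
Qed.

Lemma class_CM k f g :
  class_C k D f -> class_C k D g -> class_C k D (fun x => f x * g x).
Proof.
elim: k f g => [|k IH] f g.
  by move=> fc gc x Dx; apply: continuousM; [exact: fc|exact: gc].
move=> Cf Cg; have [[df Df] [dg Dg]] := (Cf, Cg); split=> [x Dx|v].
  by apply: differentiableM; [exact: df|exact: dg].
have := class_CD (IH _ _ (class_CW Cf) (Dg v)) (IH _ _ (class_CW Cg) (Df v)).
apply: class_C_eq => x; rewrite inE => Dx.
by rewrite deriveM//; apply: diff_derivable; [exact: df|exact: dg].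
Qed.

Lemma class_C_sum k n (f : 'I_n -> V -> R) :
  (forall i, class_C k D (f i)) -> class_C k D (fun x => \sum_(i < n) f i x).
Proof.
elim: n f => [|n IH] f Cf.
  apply: class_C_eq (class_C_cst k 0) => x _; by rewrite big_ord0.
apply: class_C_eq (class_CD (IH _ (fun i => Cf (widen_ord (leqnSn n) i)))
  (Cf ord_max)) => x _.
by rewrite big_ord_recr.
Qed.

Lemma derive_comp1 (phi : R -> R) (phi' : R) f x v :
  differentiable f x -> is_derive (f x) 1 phi phi' ->
  differentiable (phi \o f) x /\ 'D_v (phi \o f) x = phi' * 'D_v f x.
Proof.
move=> df [phid <-].
have dphi : differentiable phi (f x) by exact/derivable1_diffP.
have dc : differentiable (phi \o f) x by exact: differentiable_comp.
split => //; rewrite !deriveE// diff_comp//=.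
by rewrite diff1E//= scale1r [RHS]mulrC.
Qed.

(** The chain rule gives [phi' \o f] times a derivative of [f]. Asking for [phi'] only on values of
    [f] covers [GRing.inv] and [ln]; the regularity of [phi' \o f] is left as a premise because
    [phi'] is again built from [expR] or [GRing.inv], so inductions on [k] close. *)
Lemma class_C_comp1 k (phi phi' : R -> R) f :
  (forall x, D x -> is_derive (f x) 1 phi (phi' (f x))) ->
  class_C k.+1 D f -> class_C k D (phi' \o f) -> class_C k.+1 D (phi \o f).
Proof.
move=> dphi Cf Cphi'; have [df Df] := Cf; split=> [x Dx|v].
  by have [] := derive_comp1 0 (df x Dx) (dphi x Dx).
apply: class_C_eq (class_CM Cphi' (Df v)) => x; rewrite inE => Dx.
by have [_ ->] := derive_comp1 v (df x Dx) (dphi x Dx).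
Qed.

Lemma class_C0_comp (phi phi' : R -> R) f :
  (forall x, D x -> is_derive (f x) 1 phi (phi' (f x))) ->
  class_C 0 D f -> class_C 0 D (phi \o f).
Proof.
move=> dphi Cf x Dx; apply: continuous_comp; first exact: Cf.
apply/differentiable_continuous/derivable1_diffP.
by have [] := dphi x Dx.
Qed.

Lemma class_C_expR k f : class_C k D f -> class_C k D (expR \o f).
Proof.
elim: k f => [|k IH] f Cf.
  by apply: (@class_C0_comp expR expR).
apply: (@class_C_comp1 k expR expR) => //.
exact/IH/class_CW.
Qed.

Lemma class_CV k f :
  (forall x, D x -> f x != 0) -> class_C k D f ->
  class_C k D (GRing.inv \o f).
Proof.
move=> f0; have dV x : D x ->
    is_derive (f x) 1 GRing.inv (- ((f x)^-1 * (f x)^-1)).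
  move=> Dx; have := @is_deriveV R id (f x) 1 1 (f0 x Dx) (is_derive_id _ _).
  by move/is_derive_eq; apply; rewrite /= [LHS]mulr1 expr2 invfM.
elim: k f f0 dV => [|k IH] f f0 dV Cf.
  exact: (@class_C0_comp GRing.inv (fun y => - (y^-1 * y^-1))).
apply: (@class_C_comp1 k GRing.inv (fun y => - (y^-1 * y^-1))) => //.
have CV := IH _ f0 dV (class_CW Cf).
have := class_CM (class_C_cst k (-1 : R)) (class_CM CV CV).
by apply: class_C_eq => x _; rewrite mulN1r.
Qed.

Lemma class_C_ln k f :
  (forall x, D x -> 0 < f x) -> class_C k D f -> class_C k D (@ln R \o f).
Proof.
move=> f0; have dln x : D x -> is_derive (f x) 1 (@ln R) (f x)^-1.
  by move=> Dx; exact/is_derive1_ln/f0.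
case: k => [|k] Cf; first exact: (@class_C0_comp (@ln R) GRing.inv).
apply: (@class_C_comp1 k (@ln R) GRing.inv) => //.
by apply: class_CV (class_CW Cf) => x Dx; rewrite gt_eqF ?f0.
Qed.

End class_C_calculus.

Lemma class_CS (R : realType) (V W : normedModType R) (D E : set V) k
    (f : V -> W) : D `<=` E -> class_C k E f -> class_C k D f.
Proof.
move=> DE; elim: k f => [|k IH] f; first by move=> fc x /DE; exact: fc.
by move=> [df Df]; split=> [x /DE|v]; [exact: df|exact/IH/Df].
Qed.

(** Induction through ['D_v (f \o l) = 'D_(l v) f \o l], which has the same shape with [f] replaced
    by one of its derivatives. *)
Lemma class_C_linear_comp (R : realType) (U V W : normedModType R) (D : set U)
    (E : set V) k (l : {linear U -> V}) (f : V -> W) :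
  open D -> continuous l -> (forall x, D x -> E (l x)) ->
  class_C k E f -> class_C k D (f \o l).
Proof.
move=> oD lc DE; elim: k f => [|k IH] f.
  by move=> fc x Dx; apply: continuous_comp; [exact: lc|exact/fc/DE].
move=> [df Df].
have dl x : differentiable l x by exact: linear_differentiable.
split=> [x Dx|v].
  by apply: differentiable_comp => //; exact/df/DE.
apply: (class_C_eq oD _ (IH _ (Df (l v)))) => x; rewrite inE => Dx.
have dfx := df _ (DE _ Dx).
rewrite /= !deriveE//; last exact: differentiable_comp.
rewrite (diff_comp (dl x) dfx) /=; congr ('d f (l x) _).
exact: (congr1 (fun h : U -> V => h v) (esym (diff_lin x lc))).
Qed.

Lemma comp_class_C_linear (R : realType) (V W X : normedModType R) (D : set V)
    k (l : {linear W -> X}) (f : V -> W) :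
  open D -> continuous l -> class_C k D f -> class_C k D (l \o f).
Proof.
move=> oD lc; elim: k f => [|k IH] f.
  by move=> fc x Dx; apply: continuous_comp; [exact: fc|exact: lc].
move=> [df Df].
have dl y : differentiable l y by exact: linear_differentiable.
split=> [x Dx|v].
  by apply: differentiable_comp => //; exact: df.
apply: (class_C_eq oD _ (IH _ (Df v))) => x; rewrite inE => Dx.
have dfx := df _ Dx.
rewrite /= [RHS]deriveE; last exact: differentiable_comp.
rewrite (diff_comp dfx (dl _)) deriveE//=.
exact: (congr1 (fun h : W -> X => h _) (esym (diff_lin _ lc))).
Qed.

Lemma class_C_id (R : realType) (V : normedModType R) (D : set V) k :
  open D -> class_C k D (@id V).
Proof.
move=> oD; case: k => [|k]; first by move=> x _; exact: cvg_id.
split=> [x _|v]; first exact: ex_diff.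
by apply: (class_C_eq oD _ (class_C_cst oD k v)) => x _; rewrite derive_id.
Qed.

Lemma class_C_coord (R : realType) (V : normedModType R) (D : set V) k N
    (f : V -> 'rV[R]_N) j :
  open D -> class_C k D f -> class_C k D (fun x => f x 0 j).
Proof.
move=> oD Cf; pose c (a : 'rV[R]_N) := a 0 j.
have cl : linear c by move=> a u v; rewrite /c !mxE.
pose l : {linear 'rV[R]_N -> R} :=
  HB.pack c (GRing.isLinear.Build _ _ _ _ c cl).
by apply: (@comp_class_C_linear _ _ _ _ _ _ l) => //; exact: coord_continuous.
Qed.

(** * Second-order jets of functions of one variable *)

Section second_derivative.
Context (R : realType).

(** The first derivative is known near 0 and the second only at 0, which is just enough to compute
    [derive1 (derive1 f) 0]. Keeping [f1] as a function lets the rules below be chained. *)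
Definition jet2 (f f1 : R -> R) (f2 : R) : Prop :=
  (\forall t \near (0 : R), is_derive (t : R) (1 : R) f (f1 t)) /\
  is_derive (0 : R) (1 : R) f1 f2.

Lemma jet2_derive1 (f f1 : R -> R) (f2 : R) : jet2 f f1 f2 ->
  derive1 (derive1 f) 0 = f2.
Proof.
move=> [df [_ df1]].
rewrite derive1E -df1; apply: near_eq_derive.
by apply: filterS df => t [_ <-]; rewrite derive1E.
Qed.

Lemma is_derive_cvg (f : R -> R) (x df : R) :
  is_derive x (1 : R) f df -> {for x, continuous f}.
Proof.
by move=> [fx _]; apply/differentiable_continuous/derivable1_diffP.
Qed.

Lemma near_gt0 (f : R -> R) (x df : R) :
  is_derive x (1 : R) f df -> 0 < f x -> \forall t \near x, 0 < f t.
Proof. by move=> /is_derive_cvg fc fx; exact: (fc _ (lt_nbhsr fx)). Qed.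

Lemma is_derive_sqr (f : R -> R) (x df : R) : is_derive x (1 : R) f df ->
  is_derive x (1 : R) (fun t => f t ^+ 2) (2 * f x * df).
Proof.
move=> dfx; have := is_deriveX 2 dfx.
by move/is_derive_eq; apply; rewrite expr1.
Qed.

Lemma jet2_sqr (f f1 : R -> R) (f2 : R) : jet2 f f1 f2 ->
  jet2 (fun t => f t ^+ 2) (fun t => 2 * f t * f1 t)
       (2 * (f1 0 ^+ 2 + f 0 * f2)).
Proof.
move=> [df df1]; split; first by apply: filterS df => t; exact: is_derive_sqr.
have df0 := nbhs_singleton df.
have := is_deriveZ 2 (is_deriveM df0 df1).
have -> : (fun t => 2 * f t * f1 t) = (2 : R) *: (f * f1).
  by apply/funext => t; rewrite -mulrA.
by move/is_derive_eq; apply; rewrite /GRing.scale /=; ring.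
Qed.

(** Logarithmic differentiation: with [e] the exponential of L, e' = e L' and e'' = e (L'' + L'^2).
    Taking [ln] of [u t ^+ 2] makes the sign of [u] irrelevant. *)
Lemma jet2_expR_ln (f f1 u u1 : R -> R) (f2 u2 a b : R) :
  0 < f 0 -> u 0 != 0 -> jet2 f f1 f2 -> jet2 u u1 u2 ->
  let e t := expR (a * ln (f t) + b * ln (u t ^+ 2)) in
  jet2 e (fun t => e t * (a * (f1 t / f t) + b * (2 * (u1 t / u t))))
    (e 0 * (a * (f2 / f 0 - (f1 0 / f 0) ^+ 2) +
            b * (2 * (u2 / u 0 - (u1 0 / u 0) ^+ 2)) +
            (a * (f1 0 / f 0) + b * (2 * (u1 0 / u 0))) ^+ 2)).
Proof.
move=> f0 u0 [df df1] [du du1] e.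
have df0 := nbhs_singleton df; have du0 := nbhs_singleton du.
have u20 : 0 < u 0 ^+ 2 by rewrite exprn_even_gt0.
have fp := near_gt0 df0 f0.
have dsq : is_derive (0 : R) (1 : R) (fun t => u t ^+ 2) (2 * u 0 * u1 0).
  exact: is_derive_sqr.
have up := near_gt0 dsq u20.
have de : \forall t \near (0 : R),
    is_derive (t : R) (1 : R) e (e t * (a * (f1 t / f t) + b * (2 * (u1 t / u t)))).
  near=> t.
  have ft : 0 < f t by near: t.
  have ut : 0 < u t ^+ 2 by near: t.
  have ut0 : u t != 0 by move: ut; rewrite exprn_even_gt0.
  have dft : is_derive (t : R) (1 : R) f (f1 t) by near: t.
  have dut : is_derive (t : R) (1 : R) u (u1 t) by near: t.
  have dlf : is_derive (t : R) (1 : R) (@ln R \o f) ((f t)^-1 * f1 t).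
    exact: (is_derive1_comp (is_derive1_ln ft) dft).
  have dut2 : is_derive (t : R) (1 : R) (fun t => u t ^+ 2) (2 * u t * u1 t).
    exact: is_derive_sqr.
  have dlu : is_derive (t : R) (1 : R) (@ln R \o (fun t => u t ^+ 2))
      ((u t ^+ 2)^-1 * (2 * u t * u1 t)).
    exact: (@is_derive1_comp _ (@ln R) (fun t => u t ^+ 2) t _ _
      (is_derive1_ln ut) dut2).
  have dL : is_derive (t : R) (1 : R) (fun t => a * ln (f t) + b * ln (u t ^+ 2))
      (a * (f1 t / f t) + b * (2 * (u1 t / u t))).
    have := is_deriveD (is_deriveZ a dlf) (is_deriveZ b dlu).
    move/is_derive_eq; apply; rewrite /GRing.scale /=; field.
    by rewrite ut0 gt_eqF.
  exact: (is_derive1_comp (is_derive_expR _) dL).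
split => //.
have f00 : f 0 != 0 by rewrite gt_eqF.
have dfV := is_deriveV f00 df0; have duV := is_deriveV u0 du0.
have de0 := nbhs_singleton de.
have := is_deriveM de0 (is_deriveD (is_deriveZ a (is_deriveM df1 dfV))
  (is_deriveZ b (is_deriveZ 2 (is_deriveM du1 duV)))).
move/is_derive_eq; apply; rewrite ?fctE /GRing.scale /= /GRing.scale /=.
by field; rewrite u0 f00.
Unshelve. all: by end_near. Qed.

(* The second-order jet at 0 only sees the direction modulo the base vector. *)
Lemma jet2_reparam (f f1 : R -> R) (f2 l : R) : jet2 f f1 f2 ->
  jet2 (fun t => (1 - l * t) * f (t / (1 - l * t)))
       (fun t => f1 (t / (1 - l * t)) / (1 - l * t) - l * f (t / (1 - l * t)))
       f2.
Proof.
move=> [df df1].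
pose p t := 1 - l * t; pose s t := t / p t.
have dp t : is_derive (t : R) (1 : R) p (- l).
  have := is_deriveB (is_derive_cst (1 : R) t (1 : R))
    (is_deriveZ l (is_derive_id t (1 : R))).
  by move/is_derive_eq; apply; rewrite sub0r /GRing.scale /= mulr1.
have p0 : 0 < p 0 by rewrite /p mulr0 subr0.
(* The numerator of the quotient rule for t / p is p + l t = 1. *)
have ds t : p t != 0 -> is_derive (t : R) (1 : R) s ((p t) ^- 2).
  move=> pt; have dpV := is_deriveV pt (dp t).
  have := is_deriveM (is_derive_id t (1 : R)) dpV.
  move/is_derive_eq; apply; rewrite ?fctE /GRing.scale /=.
  by move: pt; rewrite /p => pt; field.
have s0 : s 0 = 0 by rewrite /s mul0r.
have pp := near_gt0 (dp 0) p0.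
have p00 : p 0 != 0 by rewrite gt_eqF.
have sdf : \forall t \near (0 : R), is_derive (s t) 1 f (f1 (s t)).
  have sc : s t @[t --> (0 : R)] --> (0 : R).
    by rewrite -[X in _ --> X]s0; exact: (is_derive_cvg (ds 0 p00)).
  exact: (sc _ df).
have dfs : \forall t \near (0 : R),
    is_derive (t : R) (1 : R) (f \o s) (f1 (s t) * (p t) ^- 2).
  near=> t; apply: is_derive1_comp; first by near: t.
  by apply: ds; rewrite gt_eqF//; near: t.
split.
  near=> t.
  have pt : p t != 0 by rewrite gt_eqF//; near: t.
  have dfst : is_derive (t : R) (1 : R) (f \o s) (f1 (s t) * (p t) ^- 2) by near: t.
  have := is_deriveM (dp t) dfst.
  move/is_derive_eq; apply; rewrite ?fctE /GRing.scale /=.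
  by rewrite -/(p t) -/(s t); field; exact: pt.
have df1s : is_derive (0 : R) (1 : R) (f1 \o s) (f2 * (p 0) ^- 2).
  by apply: is_derive1_comp; [rewrite s0|exact: ds].
have dfs0 := nbhs_singleton dfs.
have dpV := is_deriveV p00 (dp 0).
(* Differentiating 1 / p produces a term l f1 which cancels the one coming from - l f(s), so only
   [f2] survives because p(0) = 1. *)
have := is_deriveB (is_deriveM df1s dpV) (is_deriveZ l dfs0).
move/is_derive_eq; apply; rewrite ?fctE /GRing.scale /= s0.
by rewrite /p mulr0 subr0; field.
Unshelve. all: by end_near. Qed.

(** Meant for e(s) = F(v + s w)^2: by homogeneity the rescaled function is F(c v + s w)^2. *)
Lemma is_derive_rescale (e : R -> R) (e' c : R) :
  c != 0 -> is_derive (0 : R) (1 : R) e e' ->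
  is_derive (0 : R) (1 : R) (fun s => c ^+ 2 * e (s / c)) (c * e').
Proof.
move=> c0 de.
have dc : is_derive (0 : R) (1 : R) (fun s : R => s / c) c^-1.
  have := is_deriveZ c^-1 (is_derive_id (0 : R) (1 : R)).
  have -> : (fun s : R => s / c) = c^-1 \*: id.
    by apply/funext => s; rewrite /= mulrC.
  by move/is_derive_eq; apply; rewrite [LHS]mulr1.
have dec : is_derive (0 : R) (1 : R) (e \o (fun s : R => s / c)) (e' * c^-1).
  by apply: is_derive1_comp; rewrite mul0r.
have := is_deriveZ (c ^+ 2) dec.
by move/is_derive_eq; apply; rewrite /GRing.scale /=; field.
Qed.

End second_derivative.

(** * The tangent bundle in charts *)

Section tangent_charts.
Context (R : realType) (N : nat) (M : smoothManifold R N).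
Implicit Types (A B : set (tangent_bundle M)) (F : tangent_bundle M -> R).

Definition tchart_im A i := tchart i @` (A `&` tchart_dom i).

Lemma open_tchart_im A i : open A -> open (tchart_im A i).
Proof. exact. Qed.

Lemma open_tangent A : (forall i, open (tchart_im A i)) -> open A.
Proof. exact. Qed.

Lemma tchart_im_tchart A i p : A p -> tchart_dom i p -> tchart_im A i (tchart i p).
Proof. by move=> Ap pi; exists p. Qed.

Lemma tangent_chart_inj i (x : M) (v w : tangent x) :
  chart_dom i x -> v i = w i -> v = w.
Proof. by move=> xi vw; rewrite -(of_chartK v xi) vw of_chartK. Qed.

Lemma tangent_chart0 i (x : M) (v : tangent x) :
  chart_dom i x -> (v i == 0) = (v == 0).
Proof.
move=> xi; apply/eqP/eqP => [v0|-> //].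
exact: (tangent_chart_inj xi).
Qed.

(** In a bundle chart the base coordinate stays fixed along a fibre, so a line in the fibre is a
    straight line with direction (0, w i). The order of the summands is the one used in directional
    derivatives. *)
Lemma tchart_inv_line i (x : M) (v w : tangent x) (t : R) : chart_dom i x ->
  TVec (v + t *: w) =
  tchart_inv i (t *: ((0 : 'rV[R]_N), w i) + tchart i (TVec v)).
Proof.
move=> xi; have <- := @tchartK _ _ _ i (TVec (v + t *: w)) xi.
congr tchart_inv; rewrite /tchart /=; congr pair => /=.
  by rewrite scaler0 add0r.
by rewrite addrC.
Qed.

Lemma open_nonzero A : open A -> open (A `&` [set p | vect p != 0]).
Proof.
move=> oA; apply: open_tangent => i.
rewrite (_ : tchart_im _ i = tchart_im A i `&` snd @^-1` (~` [set 0])).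
  apply: openI; first exact: open_tchart_im.
  apply: open_comp; first by move=> z _; exact: cvg_snd.
  by apply: closed_openC; apply: accessible_closed_set1;
    exact: hausdorff_accessible (@norm_hausdorff _ _).
apply/seteqP; split=> [_ [p [[Ap p0] pi] <-]|_ [[p [Ap pi] <-]] /eqP p0].
  split; first by exists p.
  by apply/eqP; rewrite /= tangent_chart0.
by exists p => //; split=> //; split=> //; rewrite /= -(tangent_chart0 _ pi).
Qed.

(** The bundle topology is tested chart by chart, and in a chart the preimage of an open set under
    [F] is a preimage under the continuous local expression of [F]. *)
Lemma within_continuous_charts A F : open A ->
  (forall i, class_C 0 (tchart_im A i) (F \o tchart_inv i)) ->
  {within A, continuous F}.
Proof.
move=> oA Fc; rewrite continuous_open_subspace//; move=> p /set_mem Ap.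
move=> O; rewrite nbhsE; case=> O' [oO' O'p] O'O.
rewrite /= nbhs_simpl; apply: (@filterS _ _ _ (A `&` F @^-1` O')).
  by move=> r [_ /O'O].
apply: open_nbhs_nbhs; split => //=; apply: open_tangent => i.
rewrite (_ : tchart_im _ i = tchart_im A i `&` (F \o tchart_inv i) @^-1` O'); last first.
  apply/seteqP; split=> [_ [r [[Ar Fr] ri] <-]|_ [[r [Ar ri] <-]]].
    by split; [exists r|rewrite /= tchartK].
  by rewrite /= tchartK// => Fr; exists r.
rewrite openE => z [Az Oz]; apply: filterI.
  by apply: open_nbhs_nbhs; split => //; exact: open_tchart_im.
exact: (Fc i z Az _ (open_nbhs_nbhs (conj oO' Oz))).
Qed.

(** In a bundle chart the form is the sum of the products b_k(y) a_k, with smooth b depending on the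
    base coordinate y and linear coordinates a_k on the fibre. *)
Lemma form_eval_smooth (beta : one_form M) A : open A ->
  smooth_on A (form_eval beta).
Proof.
move=> oA i k; have [b bs bE] := form_smooth beta i.
have oD := @open_tchart_im A i oA.
have oI : open (chart i @` @chart_dom R N M i) := @chart_im_open R N M i.
have Cb : class_C k (tchart_im A i)
    (b \o (fst : {linear ('rV[R]_N * 'rV[R]_N)%type -> 'rV[R]_N})).
  apply: (class_C_linear_comp oD _ _ (bs k)); first by move=> z; exact: cvg_fst.
  by move=> _ [p [Ap pi] <-]; exists (base p).
have C2 : class_C k (tchart_im A i)
    (snd : {linear ('rV[R]_N * 'rV[R]_N)%type -> 'rV[R]_N}).
  have := comp_class_C_linear oD _ (class_C_id k oD) => /(_ _ snd).
  by apply => z; exact: cvg_snd.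
have := class_C_sum oD (fun j => class_CM oD (class_C_coord j oD Cb)
                                             (class_C_coord j oD C2)).
apply: class_C_eq => // _ /set_mem[p [Ap pi] <-].
by rewrite /= tchartK// /form_eval (bE _ _ pi).
Qed.

End tangent_charts.

(** * Derivatives along lines in a fibre *)

Lemma is_derive_line (R : realType) (V : normedModType R) (G : V -> R)
    (z h : V) (t : R) : derivable G (t *: h + z) h ->
  is_derive t (1 : R) (fun s : R => G (s *: h + z)) ('D_h G (t *: h + z)).
Proof.
move=> dG.
have E : (fun r : R => r^-1 *: (((fun s : R => G (s *: h + z)) \o shift t)
      (r *: (1 : R)) - G (t *: h + z))) =
    (fun r => r^-1 *: ((G \o shift (t *: h + z)) (r *: h) - G (t *: h + z))).
  apply/funext => r; congr (_ *: (G _ - _)) => /=.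
  by rewrite [r *: 1]mulr1 scalerDl addrA.
by split; rewrite /derivable /derive E.
Qed.

Lemma jet2_near (R : realType) (f g f1 : R -> R) (f2 : R) :
  {near (0 : R), f =1 g} -> jet2 f f1 f2 -> jet2 g f1 f2.
Proof.
move=> fg [df df1]; split=> //.
(* Derivatives at the points t near 0 have to be transferred, so equality is needed in a
   neighbourhood of each such t. *)
have fg' := near_join fg.
by apply: filterS2 fg' df => t fgt; exact: near_eq_is_derive.
Qed.

Lemma near_line (R : realType) (V : normedModType R) (D : set V) (h z : V) :
  open D -> D z -> \forall t \near (0 : R), D (t *: h + z).
Proof.
move=> oD Dz; have zc : (t *: h + z) @[t --> (0 : R)] --> z.
  rewrite -[X in _ --> X]add0r -[X in X + z](scale0r h).
  by apply: cvgD; [exact: scalel_continuous|exact: cvg_cst].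
exact: (zc _ (open_nbhs_nbhs (conj oD Dz))).
Qed.

Section fiber_derivatives.
Context (R : realType) (N : nat) (M : smoothManifold R N).
Implicit Types (A : set (tangent_bundle M)) (F : tangent_bundle M -> R).

Lemma fiber_near A (x : M) (v w : tangent x) : open A -> A (TVec v) ->
  \forall t \near (0 : R), A (TVec (v + t *: w)).
Proof.
move=> oA Av; have [i xi] := chart_cover x.
have Dz : tchart_im A i (tchart i (TVec v)) by exact: tchart_im_tchart.
have := near_line ((0 : 'rV[R]_N), w i) (@open_tchart_im _ _ _ A i oA) Dz.
apply: filterS => t /=; rewrite (tchart_inv_line v w t xi).
by case=> p [Ap pi] <-; rewrite tchartK.
Qed.

Lemma fiber_jet2 A F (x : M) (v w : tangent x) :
  open A -> smooth_on A F -> A (TVec v) ->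
  exists f1 f2, jet2 (fun t => F (TVec (v + t *: w))) f1 f2.
Proof.
move=> oA sF Av; have [i xi] := chart_cover x.
have Dz : tchart_im A i (tchart i (TVec v)) by exact: tchart_im_tchart.
pose h := ((0 : 'rV[R]_N), w i); pose z := tchart i (TVec v).
pose G := F \o tchart_inv i.
have -> : (fun t => F (TVec (v + t *: w))) = fun t => G (t *: h + z).
  by apply/funext => t; rewrite (tchart_inv_line v w t xi).
have [dG /(_ h)[dDG _]] := sF i 2%N.
exists (fun t => 'D_h G (t *: h + z)), ('D_h ('D_h G) z); split.
  have := near_line h (@open_tchart_im _ _ _ A i oA) Dz.
  apply: filterS => t /= Dt; apply: is_derive_line.
  exact/diff_derivable/dG.
have := @is_derive_line _ _ ('D_h G) z h 0; rewrite scale0r add0r; apply.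
exact/diff_derivable/dDG.
Qed.

(** One chart differential serves all directions w, which provides linearity in w. This is how
    g0_v(v, .) becomes a linear form whose kernel can be used. *)
Lemma fiber_differential A F (x : M) (v : tangent x) :
  open A -> smooth_on A F -> A (TVec v) ->
  exists2 d : tangent x -> R, scalar d &
    forall w, is_derive (0 : R) (1 : R) (fun t => F (TVec (v + t *: w))) (d w).
Proof.
move=> oA sF Av; have [i xi] := chart_cover x.
have Dz : tchart_im A i (tchart i (TVec v)) by exact: tchart_im_tchart.
pose z := tchart i (TVec v); pose G := F \o tchart_inv i.
have [/(_ z Dz) dG _] := sF i 1%N.
exists (fun w => 'd G z ((0 : 'rV[R]_N), w i)).
  move=> a u w; rewrite -linearP; congr ('d G z _).
  by congr pair => /=; rewrite scaler0 addr0.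
move=> w; pose h := ((0 : 'rV[R]_N), w i).
have -> : (fun t => F (TVec (v + t *: w))) = fun t => G (t *: h + z).
  by apply/funext => t; rewrite (tchart_inv_line v w t xi).
rewrite -deriveE//.
have := @is_derive_line _ _ G z h 0; rewrite scale0r add0r; apply.
exact: diff_derivable.
Qed.

(** In a chart the two forms make an N by 2 matrix, of rank at most 2 < N, so its kernel is
    nonzero. *)
Lemma scalar_kernel2 (x : M) (l1 l2 : tangent x -> R) :
  scalar l1 -> scalar l2 -> (2 < N)%N ->
  exists w, [/\ w != 0, l1 w = 0 & l2 w = 0].
Proof.
move=> s1 s2 N2; have [i xi] := chart_cover x.
have ofP a (u w : 'rV[R]_N) :
    of_chart i x (a *: u + w) = a *: of_chart i x u + of_chart i x w.
  apply: (tangent_chart_inj xi).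
  rewrite -[RHS]/(a *: of_chart i x u i + of_chart i x w i).
  by rewrite !of_chartE.
pose L (a : 'rV[R]_N) : 'rV[R]_2 :=
  \row_j (if j == 0 then l1 (of_chart i x a) else l2 (of_chart i x a)).
have linL : linear L.
  move=> a u w; apply/rowP => j; rewrite !mxE ofP.
  by case: ifP => _; [exact: s1|exact: s2].
pose L' : {linear 'rV[R]_N -> 'rV[R]_2} :=
  HB.pack L (GRing.isLinear.Build _ _ _ _ L linL).
have /rowV0Pn[a aK a0] : kermx (lin1_mx L') != 0.
  rewrite -mxrank_eq0 mxrank_ker -lt0n subn_gt0.
  exact: leq_ltn_trans (rank_leq_col _) N2.
have La : L a = 0 by rewrite -[LHS](mul_rV_lin1 L' a); exact/sub_kermxP.
exists (of_chart i x a); split.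
- by rewrite -(tangent_chart0 _ xi) of_chartE.
- by have := congr1 (fun m : 'rV[R]_2 => m 0 0) La; rewrite !mxE eqxx.
- by have := congr1 (fun m : 'rV[R]_2 => m 0 1) La; rewrite !mxE.
Qed.

End fiber_derivatives.

(** * Fundamental tensor and angular metric *)

Section fundamental_tensor_theory.
Context (R : realType) (N : nat) (M : smoothManifold R N).
Implicit Types (A : set (tangent_bundle M)) (F : tangent_bundle M -> R).

(** With both directions equal, the integrand depends on s + t only, so the inner derivative at s =
    0 is the derivative at t of a single function. *)
Lemma fundamental_tensor_diag F (x : M) (v w : tangent x) :
  fundamental_tensor F v w w =
  2^-1 * derive1 (derive1 (fun t => F (TVec (v + t *: w)) ^+ 2)) 0.
Proof.
pose e (t : R) : R := F (TVec (v + t *: w)) ^+ 2.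
have inner : (fun t => derive1 (fun s => F (TVec (v + t *: w + s *: w)) ^+ 2) 0)
    = derive1 e.
  apply/funext => t.
  have -> : (fun s : R => F (TVec (v + t *: w + s *: w)) ^+ 2) =
      (fun s => e (s + t)).
    by apply/funext => s; rewrite /e -addrA -scalerDl [t + s]addrC.
  rewrite /derive1.
  have -> // : (fun h : R => h^-1 *: (e (h + 0 + t) - e (0 + t))) =
      (fun h : R => h^-1 *: (e (h + t) - e t)).
  by apply/funext => h; rewrite addr0 add0r.
by rewrite /fundamental_tensor inner.
Qed.

Lemma fundamental_tensor_jet2 F (x : M) (v w : tangent x) f1 f2 :
  jet2 (fun t => F (TVec (v + t *: w))) f1 f2 ->
  fundamental_tensor F v w w = f1 0 ^+ 2 + F (TVec v) * f2.
Proof.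
move=> /jet2_sqr/jet2_derive1 e2.
by rewrite fundamental_tensor_diag e2 scale0r addr0 mulrA mulVf ?mul1r// pnatr_eq0.
Qed.

Lemma fundamental_tensor00 F (x : M) (v : tangent x) :
  fundamental_tensor F v 0 0 = 0.
Proof.
rewrite (@fundamental_tensor_jet2 _ _ _ _ (fun=> 0) 0).
  by rewrite expr0n mulr0 addr0.
rewrite (_ : (fun t => _) = fun=> F (TVec v)).
  split; last exact: is_derive_cst.
  by apply: filterE => t; exact: is_derive_cst.
by apply/funext => t; rewrite scaler0 addr0.
Qed.

Context A F (FA : conic_pseudo_finsler A F).

Lemma finsler_gt0 p : A p -> vect p != 0 -> 0 < F p.
Proof.
move=> Ap p0; rewrite lt_neqAle (finsler_ge0 FA Ap) andbT eq_sym.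
by apply: contraNneq p0 => /(finsler_eq0 FA Ap)/eqP.
Qed.

(** Homogeneity gives F((1+t)v + s w)^2 = (1+t)^2 F(v + s/(1+t) w)^2, so the inner derivative is
    (1+t) 2 F(v) d, affine in t. *)
Lemma fundamental_tensor_base (x : M) (v w : tangent x) (d : R) :
  A (TVec v) -> is_derive (0 : R) (1 : R) (fun t => F (TVec (v + t *: w))) d ->
  fundamental_tensor F v v w = F (TVec v) * d.
Proof.
move=> Av df; have oA := finsler_open FA.
pose e s := F (TVec (v + s *: w)) ^+ 2.
have de : is_derive (0 : R) (1 : R) e (2 * F (TVec v) * d).
  by have := is_derive_sqr df; rewrite scale0r addr0.
have inner : \forall t \near (0 : R),
    derive1 (fun s => F (TVec (v + t *: v + s *: w)) ^+ 2) 0 =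
    (1 + t) * (2 * F (TVec v) * d).
  have c0 : \forall t \near (0 : R), 0 < 1 + t.
    near=> t; rewrite -ltrBlDl sub0r; near: t; apply: lt_nbhsr.
    by rewrite oppr_lt0.
  near=> t; have ct : 0 < 1 + t by near: t.
  have cn0 : 1 + t != 0 by rewrite gt_eqF.
  have [_ <-] := is_derive_rescale cn0 de; rewrite derive1E.
  have sA : \forall s \near (0 : R), A (TVec (v + (s / (1 + t)) *: w)).
    have sc : r / (1 + t) @[r --> (0 : R)] --> (0 : R).
      rewrite -[X in _ --> X](mul0r (1 + t)^-1).
      by apply: cvgM; [exact: cvg_id|exact: cvg_cst].
    exact: (sc _ (fiber_near w oA Av)).
  apply: near_eq_derive; apply: filterS sA => s sA.
  rewrite /e -exprMn -(finsler_homogeneous FA)//.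
  congr (F (TVec _) ^+ 2); rewrite scalerDr scalerA mulrCA mulfV// mulr1.
  by rewrite scalerDl scale1r.
rewrite /fundamental_tensor derive1E (near_eq_derive _ inner).
have dl : is_derive (0 : R) (1 : R) (fun t => (1 + t) * (2 * F (TVec v) * d))
    (2 * F (TVec v) * d).
  have := is_deriveZ (2 * F (TVec v) * d)
    (is_deriveD (is_derive_cst (1 : R) (0 : R) (1 : R)) (is_derive_id (0 : R) (1 : R))).
  have -> : (fun t => (1 + t) * (2 * F (TVec v) * d)) =
      (2 * F (TVec v) * d) \*: (cst 1 + id).
    by apply/funext => t; rewrite mulrC.
  by move/is_derive_eq; apply; rewrite add0r [LHS]mulr1.
have [_ ->] := dl; field.
Unshelve. all: by end_near. Qed.

Hypothesis A_nonzero : forall p, A p -> vect p != 0.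

Lemma finsler_smooth_on : smooth_on A F.
Proof.
have AE : A `&` [set p | vect p != 0] = A.
  by apply/seteqP; split=> [p []//|p Ap]; split=> //=; exact: A_nonzero.
by have := finsler_smooth FA; rewrite AE.
Qed.

(** Since g_v(w,w) = f'^2 + f f'' and g_v(v,w) = f f', subtracting g_v(v,w)^2 / f^2 removes exactly
    f'^2. *)
Lemma angular_metric_jet2 (x : M) (v w : tangent x) f1 f2 :
  A (TVec v) -> jet2 (fun t => F (TVec (v + t *: w))) f1 f2 ->
  angular_metric F v w = F (TVec v) * f2.
Proof.
move=> Av jf; have Fv : F (TVec v) != 0.
  by rewrite gt_eqF// finsler_gt0//; exact: A_nonzero.
rewrite /angular_metric (fundamental_tensor_jet2 jf).
have df := nbhs_singleton jf.1; rewrite (fundamental_tensor_base Av df).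
by field.
Qed.

(* Subtracting from w its g_v-projection on v turns h_v(w, w) into a value of
   g_v; this replaces the Cauchy-Schwarz inequality. *)
Lemma angular_metricE (x : M) (v w : tangent x) (d : R) :
  A (TVec v) -> is_derive (0 : R) (1 : R) (fun t => F (TVec (v + t *: w))) d ->
  let u := w - (d / F (TVec v)) *: v in
  angular_metric F v w = fundamental_tensor F v u u.
Proof.
move=> Av df u; have oA := finsler_open FA.
have Fv : F (TVec v) != 0.
  by rewrite gt_eqF// finsler_gt0//; exact: A_nonzero.
have [f1 [f2 jf]] := fiber_jet2 w oA finsler_smooth_on Av.
have f10 : f1 0 = d.
  by have [_ <-] := df; have [_ <-] := nbhs_singleton jf.1.
rewrite (angular_metric_jet2 Av jf); set l := d / F (TVec v).
have jk := jet2_reparam l jf.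
(* Pulling the positive factor 1 - l t inside [F] turns the argument into (1 - l t) v + t w = v + t
   u. *)
have E : {near (0 : R), (fun t => (1 - l * t) *
    F (TVec (v + (t / (1 - l * t)) *: w))) =1 fun t => F (TVec (v + t *: u))}.
  have c0 : \forall t \near (0 : R), 0 < 1 - l * t.
    have lc : l * t @[t --> (0 : R)] --> (0 : R).
      rewrite -[X in _ --> X](mulr0 l).
      by apply: cvgM; [exact: cvg_cst|exact: cvg_id].
    near=> t; rewrite subr_gt0; near: t.
    exact: (lc _ (lt_nbhsl ltr01)).
  have sc : t / (1 - l * t) @[t --> (0 : R)] --> (0 : R).
    rewrite -[X in _ --> X](mul0r (1 - l * 0)^-1).
    apply: cvgM; first exact: cvg_id.
    apply: cvgV; first by rewrite mulr0 subr0 oner_neq0.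
    apply: cvgB; first exact: cvg_cst.
    by apply: cvgM; [exact: cvg_cst|exact: cvg_id].
  have sA : \forall t \near (0 : R), A (TVec (v + (t / (1 - l * t)) *: w)).
    exact: (sc _ (fiber_near w oA Av)).
  apply: filterS2 c0 sA => t ct tA.
  have cn0 : 1 - l * t != 0 by rewrite gt_eqF.
  rewrite -(finsler_homogeneous FA)//.
  congr (F (TVec _)); rewrite scalerDr scalerA mulrCA mulfV// mulr1 /u.
  rewrite scalerBl scale1r scalerBr scalerA [t * l]mulrC.
  by rewrite addrAC addrA.
(* The choice of [l] makes the first derivative along u, which is d - l F(v), vanish; only F(v) [f2]
   remains. *)
rewrite (fundamental_tensor_jet2 (jet2_near E jk)) mul0r mulr0 subr0 divr1.
rewrite scale0r addr0 f10.
by rewrite /l divfK// subrr expr0n add0r.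
Unshelve. all: by end_near. Qed.

End fundamental_tensor_theory.

(** * The metric F0^(q+1) / |F0 - beta|^q on conic domains *)

Lemma ln_sqr (R : realType) (u : R) : u != 0 -> ln (u ^+ 2) = 2 * ln `|u|.
Proof.
move=> u0; rewrite -(real_normK (num_real u)) lnXn ?normr_gt0//.
by rewrite mulr_natl.
Qed.

(** Replaces the absolute value and the real powers by [expR], [ln] and a square, all smooth where
    they are used whatever the sign of [u]. *)
Lemma powR_quotientE (R : realType) (f u q : R) : 0 < f -> u != 0 ->
  f `^ (q + 1) / `|u| `^ q = expR ((q + 1) * ln f + (- (q / 2)) * ln (u ^+ 2)).
Proof.
move=> f0 u0; have nu : 0 < `|u| by rewrite normr_gt0.
rewrite -powRN /powR !gt_eqF// -expRD; congr (expR (_ + _)).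
by rewrite ln_sqr//; field.
Qed.

Section power_metric.
Context (R : realType) (N : nat) (M : smoothManifold R N).
Context (A0 : set (tangent_bundle M)) (F0 : tangent_bundle M -> R).
Context (beta : one_form M) (q : R).
Hypothesis F0A : conic_pseudo_finsler A0 F0.

Definition power_metric (p : tangent_bundle M) : R :=
  F0 p `^ (q + 1) / `|F0 p - form_eval beta p| `^ q.

Variable U : set (R * R).
Hypothesis oU : open U.
Hypothesis U_diag : forall z, U z -> z.1 != z.2.
Hypothesis U_cone : forall (l : R) z, 0 < l -> U z -> U (l * z.1, l * z.2).

(** Both A and A^* are cut out of [A0] by a condition on the pair of values of [F0] and [beta];
    keeping the conic open set [U] abstract treats them together. *)
Definition cone_domain : set (tangent_bundle M) :=
  [set p | A0 p /\ U (F0 p, form_eval beta p)].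

(** At a zero vector [F0] and [beta] both vanish, giving a pair on the diagonal, which [U]
    avoids. *)
Lemma cone_domain_nonzero p : cone_domain p -> vect p != 0.
Proof.
move=> [A0p /U_diag/= Fb]; apply: contra_neq Fb => p0.
rewrite (finsler_eq0 F0A A0p).2// /form_eval p0.
by rewrite linear0.
Qed.

Lemma class_C_cone k i : 
  class_C k (tchart_im (A0 `&` [set p | vect p != 0]) i) (F0 \o tchart_inv i) /\
  class_C k (tchart_im (A0 `&` [set p | vect p != 0]) i)
    (form_eval beta \o tchart_inv i).
Proof.
split; first exact: (finsler_smooth F0A i k).
apply: form_eval_smooth; apply: open_nonzero; exact: finsler_open F0A.
Qed.

Lemma open_cone_domain : open cone_domain.
Proof.
apply: open_tangent => i; set D := tchart_im (A0 `&` [set p | vect p != 0]) i.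
have oD : open D by apply: open_tchart_im; exact: open_nonzero (finsler_open F0A).
have [G0 B0] := class_C_cone 0 i.
pose H z := (F0 (tchart_inv i z), form_eval beta (tchart_inv i z)).
rewrite (_ : tchart_im _ i = D `&` H @^-1` U); last first.
  apply/seteqP; split=> [_ [p [Bp pi] <-]|_ [[p [[Ap p0] pi] <-]]].
    split; last by rewrite /H /= tchartK//; case: Bp.
    by exists p => //; split=> //; split; [case: Bp|exact: cone_domain_nonzero].
  by rewrite /H /= tchartK// => Up; exists p.
rewrite openE => z [Dz Uz]; apply: filterI.
  by apply: open_nbhs_nbhs.
have Hc : H y @[y --> z] --> H z by exact: (cvg_pair (G0 z Dz) (B0 z Dz)).
exact: (Hc _ (open_nbhs_nbhs (conj oU Uz))).
Qed.

Lemma cone_domain_gt0 p : cone_domain p -> 0 < F0 p.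
Proof.
by move=> Bp; apply: (finsler_gt0 F0A); [case: Bp|exact: cone_domain_nonzero].
Qed.

Lemma cone_domain_neq p : cone_domain p -> F0 p - form_eval beta p != 0.
Proof. by move=> [_ /U_diag]; rewrite subr_eq0. Qed.

Lemma form_evalZ (x : M) (v : tangent x) l :
  form_eval beta (TVec (l *: v)) = l * form_eval beta (TVec v).
Proof. by rewrite /form_eval /= linearZ. Qed.

Lemma cone_domain_conic (x : M) (v : tangent x) l :
  0 < l -> cone_domain (TVec v) -> cone_domain (TVec (l *: v)).
Proof.
move=> l0 [Av Uv]; split; first exact: (finsler_conic F0A).
by rewrite (finsler_homogeneous F0A)// form_evalZ; exact: (U_cone l0 Uv).
Qed.

Lemma power_metric_smooth : smooth_on cone_domain power_metric.
Proof.
move=> i k; have oE : open (tchart_im cone_domain i).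
  by apply: open_tchart_im; exact: open_cone_domain.
have sub : tchart_im cone_domain i `<=`
    tchart_im (A0 `&` [set p | vect p != 0]) i.
  move=> _ [p [Bp pi] <-]; exists p => //; split=> //.
  by split; [case: Bp|exact: cone_domain_nonzero].
have [/(class_CS sub) CF /(class_CS sub) Cb] := class_C_cone k i.
have Cu := class_CD oE CF (class_CM oE (class_C_cst oE k (-1 : R)) Cb).
have G_gt0 z : tchart_im cone_domain i z -> 0 < (F0 \o tchart_inv i) z.
  by move=> [p [Bp pi] <-]; rewrite /= tchartK//; exact: cone_domain_gt0.
have u_gt0 z : tchart_im cone_domain i z ->
    0 < ((F0 \o tchart_inv i) z + -1 * (form_eval beta \o tchart_inv i) z) *
        ((F0 \o tchart_inv i) z + -1 * (form_eval beta \o tchart_inv i) z).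
  move=> [p [Bp pi] <-]; rewrite /= tchartK// mulN1r -expr2.
  by rewrite exprn_even_gt0//=; exact: cone_domain_neq.
have := class_C_expR oE (class_CD oE
  (class_CM oE (class_C_cst oE k (q + 1)) (class_C_ln oE G_gt0 CF))
  (class_CM oE (class_C_cst oE k (- (q / 2)))
     (class_C_ln oE u_gt0 (class_CM oE Cu Cu)))).
apply: class_C_eq => // _ /set_mem[p [Bp pi] <-].
have Fp := cone_domain_gt0 Bp; have up := cone_domain_neq Bp.
by rewrite /= tchartK// mulN1r -expr2 -powR_quotientE.
Qed.

Hypothesis B_proj : @base R N M @` cone_domain = [set: M].

(** [A0] may contain zero vectors, where [F0] need not be smooth; restricting [F0] to this domain
    makes the results that assume [A_nonzero] applicable to it. *)
Lemma cone_domain_finsler : conic_pseudo_finsler cone_domain F0.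
Proof.
have sub p : cone_domain p -> A0 p by case.
split => //.
- exact: open_cone_domain.
- exact: cone_domain_conic.
- apply: within_continuous_charts; first exact: open_cone_domain.
  move=> i; have [+ _] := class_C_cone 0 i; apply: class_CS.
  move=> _ [p [Bp pi] <-]; exists p => //; split=> //.
  by split; [case: Bp|exact: cone_domain_nonzero].
- by move=> p /sub; exact: (finsler_ge0 F0A).
- move=> i k; have [+ _] := class_C_cone k i; apply: class_CS.
  by move=> _ [p [[[Bp _] p0] pi] <-]; exists p.
- by move=> p /sub; exact: (finsler_eq0 F0A).
- by move=> x v l l0 /sub; exact: (finsler_homogeneous F0A).
Qed.

Lemma power_metric_finsler : conic_pseudo_finsler cone_domain power_metric.
Proof.
split => //.
- exact: open_cone_domain.
- exact: cone_domain_conic.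
- apply: within_continuous_charts; first exact: open_cone_domain.
  by move=> i; exact: power_metric_smooth.
- by move=> p _; rewrite /power_metric mulr_ge0// ?invr_ge0 powR_ge0.
- move=> i k; apply: class_CS (power_metric_smooth i k).
  by move=> _ [p [[Bp p0] pi] <-]; exists p.
(* Both sides of the equivalence are false: the domain has no zero vector and an exponential does
   not vanish. *)
- move=> p Bp; split=> [|p0]; last first.
    by have := cone_domain_nonzero Bp; rewrite p0 eqxx.
  have Fp := cone_domain_gt0 Bp; have up := cone_domain_neq Bp.
  by rewrite /power_metric powR_quotientE// => /eqP; rewrite gt_eqF// expR_gt0.
- move=> x v l l0 Bv; have Fp := cone_domain_gt0 Bv.
  have up := cone_domain_neq Bv; have [Av _] := Bv.
  rewrite /power_metric (finsler_homogeneous F0A)// form_evalZ -mulrBr normrM.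
  rewrite (gtr0_norm l0) !powRM// ?ltW// powRD; last by rewrite (gt_eqF l0) implybT.
  have lq : l `^ q != 0 by rewrite gt_eqF// powR_gt0.
  have uq : `|F0 (TVec v) - form_eval beta (TVec v)| `^ q != 0.
    by rewrite gt_eqF// powR_gt0// normr_gt0.
  by rewrite powRr1 ?ltW//; field; rewrite lq uq.
Qed.

Lemma power_metric_tensor (x : M) (v w : tangent x) : cone_domain (TVec v) ->
  let f := F0 (TVec v) in
  let b := beta x v in
  let g0vw := fundamental_tensor F0 v v w in
  `|(f - b) / f| `^ (2 * q + 2) * fundamental_tensor power_metric v w w =
    (f - b) * (f - (q + 1) * b) / f ^+ 2 * angular_metric F0 v w
    + q * (q + 1) * (b / f ^+ 2 * g0vw - beta x w) ^+ 2
    + ((f - (q + 1) * b) / f ^+ 2 * g0vw + q * beta x w) ^+ 2.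
Proof.
move=> Bv f b g0vw; have oB := open_cone_domain.
have F0B := cone_domain_finsler.
have sF0 := finsler_smooth_on F0B cone_domain_nonzero.
have [f1 [f2 jf]] := fiber_jet2 w oB sF0 Bv.
have f0 : 0 < f := cone_domain_gt0 Bv.
have u0 : f - b != 0 := cone_domain_neq Bv.
(* [beta] is affine along the line, so f - beta has the same second derivative as f. *)
have ju : jet2 (fun t => F0 (TVec (v + t *: w)) - form_eval beta (TVec (v + t *: w)))
    (fun t => f1 t - beta x w) f2.
  have db (t : R) : is_derive (t : R) (1 : R)
      (fun t : R => form_eval beta (TVec (v + t *: w))) (beta x w).
    have := is_deriveD (is_derive_cst (beta x v) (t : R) (1 : R))
      (is_deriveZ (beta x w) (is_derive_id (t : R) (1 : R))).
    have -> : (fun t : R => form_eval beta (TVec (v + t *: w))) =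
        cst (beta x v) + beta x w \*: id.
      apply/funext => s; rewrite /form_eval /= linearD linearZ.
      by congr (_ + _); exact: mulrC.
    by move/is_derive_eq; apply; rewrite add0r [LHS]mulr1.
  split; first by apply: filterS jf.1 => t dt; exact: is_deriveB.
  have := is_deriveB jf.2 (is_derive_cst (beta x w) (0 : R) (1 : R)).
  by move/is_derive_eq; apply; rewrite subr0.
have v0 : v + (0 : R) *: w = v by rewrite scale0r addr0.
have f00 : 0 < F0 (TVec (v + (0 : R) *: w)) by rewrite v0.
have u00 : F0 (TVec (v + (0 : R) *: w)) - form_eval beta (TVec (v + (0 : R) *: w)) != 0.
  by rewrite v0.
have je := jet2_expR_ln (q + 1) (- (q / 2)) f00 u00 jf ju.
have E : {near (0 : R), (fun t : R => expR ((q + 1) * ln (F0 (TVec (v + t *: w))) +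
    (- (q / 2)) * ln ((F0 (TVec (v + t *: w)) -
       form_eval beta (TVec (v + t *: w))) ^+ 2))) =1
    fun t => power_metric (TVec (v + t *: w))}.
  apply: filterS (fiber_near w oB Bv) => t Bt.
  by rewrite /power_metric powR_quotientE//;
    [exact: cone_domain_gt0|exact: cone_domain_neq].
rewrite (fundamental_tensor_jet2 (jet2_near E je)).
rewrite (angular_metric_jet2 F0B cone_domain_nonzero Bv jf) {}/g0vw.
rewrite (fundamental_tensor_base F0B Bv (nbhs_singleton jf.1)).
rewrite -/f v0 -/f -[form_eval beta _]/b /power_metric (powR_quotientE _ f0 u0).
set e := expR _; set m := beta x w.
(* Here e = f^(q+1) / |f - b|^q, so the prefactor in the formula cancels every real power and leaves
   a rational identity. *)
have key : `|(f - b) / f| `^ (2 * q + 2) * e ^+ 2 = (f - b) ^+ 2.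
  have nu : 0 < `|f - b| by rewrite normr_gt0.
  rewrite normrM normfV (gtr0_norm f0) /powR gt_eqF ?divr_gt0//.
  rewrite ln_div// -expRM_natl -expRD.
  have -> : (f - b) ^+ 2 = expR (ln ((f - b) ^+ 2)).
    by rewrite lnK// posrE exprn_even_gt0.
  by congr expR; rewrite ln_sqr// expRK; field.
(* With L the exponent of e, e'^2 + e e'' = e^2 (2 L'^2 + L''), so [e] occurs only through the
   factor handled by [key]. *)
transitivity ((`|(f - b) / f| `^ (2 * q + 2) * e ^+ 2) *
  (2 * ((q + 1) * (f1 0 / f) + - (q / 2) * (2 * ((f1 0 - m) / (f - b)))) ^+ 2 +
   ((q + 1) * (f2 / f - (f1 0 / f) ^+ 2) +
            - (q / 2) * (2 * (f2 / (f - b) - ((f1 0 - m) / (f - b)) ^+ 2))))).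
  by ring.
by rewrite key; field; rewrite u0 gt_eqF.
Qed.

End power_metric.

(** * Positivity on A^* and its failure off A^* *)

Lemma continuous_fst_subM_snd (R : realType) (c : R) :
  continuous (fun z : R * R => z.1 - c * z.2).
Proof.
move=> z; apply: cvgB; first exact: cvg_fst.
by apply: cvgM; [exact: cvg_cst|exact: cvg_snd].
Qed.

Theorem corollary4p13 (R : realType) (N : nat) (M : smoothManifold R N)
    (A0 : set (tangent_bundle M)) (F0 : tangent_bundle M -> R)
    (beta : one_form M) (q : R) :
  conic_finsler A0 F0 ->
  q != 0 ->
  let A : set (tangent_bundle M) :=
    [set p | A0 p /\ F0 p <> form_eval beta p] in
  let F : tangent_bundle M -> R := fun p =>
    F0 p `^ (q + 1) / `|F0 p - form_eval beta p| `^ q in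
  let Astar : set (tangent_bundle M) :=
    [set p | A0 p /\ 0 < (F0 p - (q + 1) * form_eval beta p) *
                         (F0 p - form_eval beta p)] in
  @base R N M @` A = [set: M] ->
  [/\ conic_pseudo_finsler A F,
      forall (x : M) (v w : tangent x), A (TVec v) ->
        let f := F0 (TVec v) in
        let b := beta x v in
        let g0vw := fundamental_tensor F0 v v w in
        `|(f - b) / f| `^ (2 * q + 2) * fundamental_tensor F v w w =
          (f - b) * (f - (q + 1) * b) / f ^+ 2 * angular_metric F0 v w
          + q * (q + 1) * (b / f ^+ 2 * g0vw - beta x w) ^+ 2
          + ((f - (q + 1) * b) / f ^+ 2 * g0vw + q * beta x w) ^+ 2
    & (0 < q \/ q <= -1) ->
      [/\ Astar `<=` A,
          forall p, Astar p -> strongly_convex_at F p,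
          @base R N M @` Astar = [set: M] -> conic_finsler Astar F
        & (2 < N)%N -> forall p, (A `\` Astar) p -> ~ strongly_convex_at F p]].
Proof.
move=> [F0A F0sc] q0 A F Astar Aproj.
(* [A] and [Astar] are convertible to the cone domains of [U] and [Us], so results on cone domains
   apply to them directly. *)
pose U : set (R * R) := [set z | z.1 <> z.2].
pose Us : set (R * R) :=
  [set z | 0 < (z.1 - (q + 1) * z.2) * (z.1 - z.2)].
have cont1 : continuous (fun z : R * R => z.1 - z.2).
  move=> z; have := @continuous_fst_subM_snd R 1 z.
  by under eq_fun do rewrite mul1r.
have oU : open U.
  rewrite (_ : U = (fun z : R * R => z.1 - z.2) @^-1` (~` [set 0])).
    apply: open_comp => [z _|]; first exact: cont1.
    apply/closed_openC/accessible_closed_set1/hausdorff_accessible.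
    exact: norm_hausdorff.
  apply/seteqP; split=> z /= zU; first by move/eqP; rewrite subr_eq0 => /eqP.
  by move=> z12; apply: zU; rewrite z12 subrr.
have oUs : open Us.
  apply: (@open_comp _ _ (fun z : R * R => (z.1 - (q + 1) * z.2) * (z.1 - z.2))
    [set y | 0 < y]); last exact: open_gt.
  by move=> z _; apply: cvgM; [exact: continuous_fst_subM_snd|exact: cont1].
have dU z : U z -> z.1 != z.2 by move=> zU; exact/eqP.
have dUs z : Us z -> z.1 != z.2.
  by rewrite /Us /=; apply: contraTneq => ->; rewrite subrr mulr0 ltxx.
have cU (l : R) z : 0 < l -> U z -> U (l * z.1, l * z.2).
  by move=> l0 zU /= /(mulfI (lt0r_neq0 l0)).
have cUs (l : R) z : 0 < l -> Us z -> Us (l * z.1, l * z.2).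
  move=> l0; rewrite /Us /= => zU.
  rewrite [X in _ < X](_ : _ = l ^+ 2 * ((z.1 - (q + 1) * z.2) * (z.1 - z.2))).
    by rewrite mulr_gt0// exprn_gt0.
  by ring.
have tensor x (v w : tangent x) (Av : A (TVec v)) :=
  @power_metric_tensor _ _ _ _ _ beta q F0A U oU dU cU Aproj x v w Av.
have F0B := cone_domain_finsler F0A oU dU cU Aproj.
have A0n := @cone_domain_nonzero _ _ _ _ _ beta F0A U dU.
have AsA : Astar `<=` A.
  by move=> p [A0p Up]; split=> //; apply/eqP; exact: (dUs (F0 p, _) Up).
split.
- exact: (@power_metric_finsler _ _ _ _ _ beta q F0A U oU dU cU Aproj).
- exact: tensor.
move=> qq.
(* The range of q enters only here: it makes the coefficient of the first square nonnegative. *)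
have qq1 : 0 <= q * (q + 1).
  case: qq => [q_gt0|q_le]; first by rewrite mulr_ge0// ?ltW// addr_gt0.
  by rewrite mulr_le0// ?(le_trans q_le)// -lerBrDr sub0r.
have sc p : Astar p -> strongly_convex_at F p.
  case: p => x v Asv w w0 /=; have Av := AsA _ Asv.
  have {tensor} := tensor x v w Av; have [A0v Usv] := Asv.
  have f0 := cone_domain_gt0 F0A dU Av; have u0 := cone_domain_neq dU Av.
  have [d _ /(_ w) dw] := fiber_differential (open_cone_domain F0A oU dU)
    (finsler_smooth_on F0B A0n) Av.
  rewrite (fundamental_tensor_base F0B Av dw) (angular_metricE F0B A0n Av dw).
  move: u0 f0 Usv; rewrite /form_eval /=.
  set f := F0 _; set b := beta x v; set c := beta x w; set u := w - _.
  move=> u0 f0 Usv.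
  have X0 : 0 < `|(f - b) / f| `^ (2 * q + 2).
    by rewrite powR_gt0// normr_gt0 mulf_neq0// invr_neq0// gt_eqF.
  move=> E; rewrite -(pmulr_rgt0 _ X0) E.
  have c0 : 0 < (f - b) * (f - (q + 1) * b) / f ^+ 2.
    by rewrite divr_gt0 ?exprn_gt0// mulrC.
  (* If u = 0 then w = l v with l = d w / f nonzero: the h0-term vanishes and the last square
     becomes (l (f - b))^2 > 0. *)
  have [uz|un] := eqVneq u 0.
    have wE : w = (d w / f) *: v by apply/eqP; rewrite -subr_eq0; exact/eqP.
    have dw0 : d w / f != 0.
      by apply: contraNneq w0 => l0; rewrite wE l0 scale0r.
    have cE : c = d w / f * b by rewrite /c {1}wE linearZ.
    rewrite uz fundamental_tensor00 mulr0 add0r.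
    apply: ltr_wpDl; first by apply: mulr_ge0 => //; exact: sqr_ge0.
    rewrite (_ : _ + _ = d w / f * (f - b)).
      by rewrite exprn_even_gt0//= mulf_neq0.
    by rewrite cE; field; rewrite gt_eqF.
  (* If u is nonzero, the h0-term is g0_v(u,u) > 0 times a coefficient positive on A^*, and the
     squares only add to it. *)
  rewrite -addrA; apply: ltr_wpDr.
    by apply: addr_ge0; [apply: mulr_ge0 => //|]; exact: sqr_ge0.
  apply: mulr_gt0 => //; apply: (F0sc (TVec v)) => //.
  exact: A0n Av.
split => //.
- move=> Asproj; split; last by move=> p Asp _; exact: sc.
  exact: (@power_metric_finsler _ _ _ _ _ beta q F0A Us oUs dUs cUs Asproj).
- move=> N2 [x v] [Av nAs] /= scv; have [A0v _] := Av.
  have f0 := cone_domain_gt0 F0A dU Av; have u0 := cone_domain_neq dU Av.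
  have [d sd dw] := fiber_differential (open_cone_domain F0A oU dU)
    (finsler_smooth_on F0B A0n) Av.
  (* As g0_v(v, .) is F0(v) times [d], both squares vanish at this w. Moreover w equals its own
     orthogonal component, so h0_v(w,w) = g0_v(w,w). *)
  have [w [w0 dw0 bw0]] := scalar_kernel2 sd (@linearP _ _ _ _ (beta x)) N2.
  have gw := scv w w0; have := tensor x v w Av.
  rewrite (fundamental_tensor_base F0B Av (dw w)).
  rewrite (angular_metricE F0B A0n Av (dw w)) dw0 mul0r scale0r subr0 bw0.
  rewrite /= !mulr0 subr0 addr0 expr0n !mulr0 !addr0.
  move: u0 f0 nAs; rewrite /Astar /form_eval /=.
  set f := F0 _; set b := beta x v => u0 f0 nAs E.
  have X0 : 0 < `|(f - b) / f| `^ (2 * q + 2).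
    by rewrite powR_gt0// normr_gt0 mulf_neq0// invr_neq0// gt_eqF.
  (* Strong convexity would make the left side positive, while off A^* the right side is a
     nonpositive coefficient times g0_v(w,w) > 0. *)
  have := mulr_gt0 X0 gw; rewrite E; apply/negP; rewrite -leNgt.
  have h0 : 0 < fundamental_tensor F0 v w w.
    by apply: (F0sc (TVec v)) => //; exact: A0n Av.
  apply: mulr_le0_ge0; last exact: ltW.
  apply: mulr_le0_ge0; last by rewrite invr_ge0 sqr_ge0.
  rewrite mulrC leNgt.
  by apply/negP => pos; apply: nAs.
Qed.
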